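(* Let $\lambda,\mu>0$, $\varrho=\lambda/\mu$, $N\in\mathbb N$, and write $g=g(\varrho,N)=1/{}_2F_1(-N,1;1+N;-\varrho)$. Let $\mathcal N$ be a random variable with the stationary law of the number of particles in the multi-type Ehrenfest system, i.e. $\mathbb P(\mathcal N=k)=\lim_{t\to+\infty}\mathbb P(\mathcal N(t)=k)$, $k=0,\dots,N$. Then its mean, variance and coefficient of variation are $$E[\mathcal N]=\frac{N}{1+\varrho}\left[\varrho-1+g\right],$$ $$Var[\mathcal N]=\frac{N}{(1+\varrho)^2}\left[\varrho(2-g-gN)+N(1-g)g\right],$$ $$CV[\mathcal N]=\sqrt{\frac{\varrho(2-g)}{N\left[\varrho-1+g\right]^2}-\frac{g}{\varrho-1+g}}.$$
   Context: Multi-type Ehrenfest model: let $N,d\in\mathbb N$, $D=\{1,\dots,d\}$, $\lambda,\mu>0$, and let $C=(c_{l,j})_{l,j\in D}$ be a stochastic matrix ($c_{l,j}\ge 0$, $\sum_{j}c_{l,j}=1$). The system is a continuous-time Markov chain with states $(k,j)$, $k\in\{1,\dots,N\}$, $j\in D$ ($k$ particles, all of type $j$), and the empty states $(0,l)$, $l\in D$ (no particle, the last particles in the system having been of type $l$). The only transitions are: $(k,j)\to(k-1,j)$ at rate $\mu(N+k)$ for $1\le k\le N$; $(k,j)\to(k+1,j)$ at rate $\lambda(N-k)$ for $1\le k\le N-1$; $(0,l)\to(1,j)$ at rate $c_{l,j}\lambda N$. At time $0$ the chain is in $(0,l_0)$ for a fixed $l_0\in D$. $\mathcal N(t)\in\{0,1,\dots,N\}$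 denotes the number of particles (first coordinate) at time $t$. ${}_2F_1(a,b;c;z)=\sum_{n\ge0}\frac{(a)_n(b)_n}{(c)_n}\frac{z^n}{n!}$ is the Gauss hypergeometric function (a finite sum when $a$ is a nonpositive integer), $(a)_n=a(a+1)\cdots(a+n-1)$. The coefficient of variation is $CV[\mathcal N]=\sqrt{Var[\mathcal N]}/E[\mathcal N]$. *)

(* Defs.v *)
From HB Require Import structures.
From mathcomp Require Import all_boot all_order all_algebra.
From mathcomp Require Import all_classical all_reals all_analysis.

Set Implicit Arguments.
Unset Strict Implicit.
Unset Printing Implicit Defensive.

Import Order.TTheory GRing.Theory Num.Theory.
Import numFieldNormedType.Exports.

Local Open Scope classical_set_scope.
Local Open Scope ring_scope.

Definition pochhammer (R : realType) (a : R) (n : nat) : R :=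
  \prod_(i < n) (a + i%:R).

Definition hyp2F1 (R : realType) (a b c z : R) : R :=
  limn (series (fun n =>
    pochhammer a n * pochhammer b n / pochhammer c n * (z ^+ n / n`!%:R))).

(* [p t x y] is the probability of going from [x] to [y] in time [t]; only its
   values at times [t >= 0] matter. *)
Definition transition_function (R : realType) (S : finType)
    (p : R -> S -> S -> R) : Prop :=
  [/\ forall t x y, 0 <= t -> 0 <= p t x y,
      forall t x, 0 <= t -> \sum_y p t x y = 1,
      forall x y, p 0 x y = (x == y)%:R
    & forall s t x y, 0 <= s -> 0 <= t ->
        p (s + t) x y = \sum_z p s x z * p t z y].

(* The Q-matrix with off-diagonal entries [q x y] and zero row sums; the
   diagonal values of [q] are ignored. *)
Definition generator (R : realType) (S : finType) (q : S -> S -> R)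
    (x y : S) : R :=
  if x == y then - \sum_(z | z != x) q x z else q x y.

Definition has_rates (R : realType) (S : finType) (p : R -> S -> S -> R)
    (q : S -> S -> R) : Prop :=
  forall x y, (p h x y - (x == y)%:R) / h @[h --> 0^'+] --> generator q x y.

(* The Markov property is written as a product, so that conditioning on null
   events needs no convention. No path regularity is required. *)
Definition markov_chain (R : realType) (disp : measure_display)
    (Omega : measurableType disp) (P : probability Omega R) (S : finType)
    (q : S -> S -> R) (x0 : S) (X : R -> Omega -> S) : Prop :=
  [/\ forall t x, 0 <= t -> measurable (X t @^-1` [set x]),
      P (X 0 @^-1` [set x0]) = 1%E
    & exists p : R -> S -> S -> R,
      [/\ transition_function p,
          has_rates p q
        & forall (n : nat) (t : nat -> R) (x : nat -> S),
            0 <= t 0%N -> (forall i, t i < t i.+1) ->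
            P [set w | forall i, (i <= n.+1)%N -> X (t i) w = x i] =
            (P [set w | forall i, (i <= n)%N -> X (t i) w = x i] *
             (p (t n.+1 - t n) (x n) (x n.+1))%:E)%E]].

Definition stochastic_matrix (R : realType) (d : nat) (C : 'M[R]_d) : Prop :=
  (forall l j, 0 <= C l j) /\ (forall l, \sum_j C l j = 1).

(* A state [(k, j)] means [k] particles, all of type [j]; for [k = 0], [j] is
   the type of the last particles. *)
Definition ehrenfest_rate (R : realType) (N d : nat) (lambda mu : R)
    (C : 'M[R]_d) (x y : 'I_N.+1 * 'I_d) : R :=
  let: (k, i) := x in
  let: (m, j) := y in
  if k == 0%N :> nat then
    if m == 1%N :> nat then C i j * lambda * N%:R else 0
  else if i != j then 0
  else if m.+1 == k :> nat then mu * (N + k)%:R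
  else if m == k.+1 :> nat then lambda * (N - k)%:R
  else 0.

Definition number_law (R : realType) (disp : measure_display)
    (Omega : measurableType disp) (P : probability Omega R) (N d : nat)
    (X : R -> Omega -> 'I_N.+1 * 'I_d) (k : 'I_N.+1) (t : R) : R :=
  fine (P [set w | (X t w).1 = k]).

Definition coefficient_of_variation (R : realType) (disp : measure_display)
    (Omega : measurableType disp) (P : probability Omega R)
    (Y : Omega -> R) : R :=
  Num.sqrt (fine 'V_P[Y]) / fine 'E_P[Y].

(* Main.v *)
(** Summing over types, the particle number is a birth-death chain with birth
    rates [b k = lambda (N - k)] and death rates [d k = mu (N + k)], except that
    there is no death at 0. Let [V k] be the difference between the
    distribution function of the particle number at time [t] and that of the
    detailed-balance law. By the forward equation the [V k], 0 < k <= N,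
    satisfy a linear system in which each [|V k|] contributes at most
    [d (k-1) + b k - d k - b (k-1) = - (lambda + mu)] to the derivative of the
    l1 norm. The norm therefore decays exponentially, and it suffices to know
    this up to an error [o(h)] uniform in time for steps of length [h]. Mean and
    variance follow by testing detailed balance against 1 and k; the
    normalising constant of the weights is the terminating 2F1. *)
Require Import Defs.
From HB Require Import structures.
From mathcomp Require Import all_boot all_order all_algebra.
From mathcomp Require Import all_classical all_reals all_analysis.
From mathcomp Require Import measurable_realfun ring lra.

Set Implicit Arguments.
Unset Strict Implicit.
Unset Printing Implicit Defensive.

Import Order.TTheory GRing.Theory Num.Theory.
Import numFieldNormedType.Exports.

Local Open Scope classical_set_scope.
Local Open Scope ring_scope.

(** * Analytic tools: decay from short-time inequalities, and the forward equation *)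

(** A single step length [h] is fixed and the inequality iterated. The bound [M] holds at every
    starting time, so a large [t] is reached by [n] steps from [t - n h], with [n] chosen once and
    for all. *)
Lemma discrete_gronwall_cvg0 (R : realType) (W : R -> R) (M c : R) :
  0 < c -> (forall t : R, 0 <= t -> 0 <= W t <= M) ->
  (forall e : R, 0 < e -> \forall h \near 0^'+,
     forall t : R, 0 <= t -> W (t + h) <= (1 - c * h) * W t + e * h) ->
  W t @[t --> +oo] --> 0.
Proof.
move=> c0 WM Wstep; apply/cvgrPdist_le => e e0.
(* With error [e * c / 2 * h] per step, the fixed point of the affine recursion is [e / 2]; the
   other half of [e] is left for the geometric term. *)
have ec0 : 0 < e * c / 2 by rewrite divr_gt0 ?mulr_gt0.
have [h [h0 hc Wh]] : exists h, [/\ 0 < h, h * c < 1 & forall t, 0 <= t ->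
    W (t + h) <= (1 - c * h) * W t + e * c / 2 * h].
  near (0 : R)^'+ => h; exists h; split; near: h.
  - exact: nbhs_right_gt.
  - near=> h; rewrite -ltr_pdivlMr// mul1r; near: h.
    by apply: nbhs_right_lt; rewrite invr_gt0.
  - exact: Wstep.
have ch1 : 0 < 1 - c * h < 1.
  by rewrite subr_gt0 mulrC hc /= ltrBlDr ltrDl mulr_gt0.
have Wn n t : 0 <= t -> W (t + n%:R * h) <= (1 - c * h) ^+ n * M + e / 2.
  move=> t0; elim: n => [|n IHn].
    rewrite mul0r addr0 expr0 mul1r; case/andP: (WM _ t0) => _ /le_trans; apply.
    by rewrite lerDl divr_ge0// ltW.
  have tn0 : 0 <= t + n%:R * h by rewrite addr_ge0// mulr_ge0// ltW.
  rewrite -natr1 mulrDl mul1r addrA (le_trans (Wh _ tn0))//.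
  have := ler_wpM2l (ltW (andP ch1).1) IHn.
  by rewrite exprS; lra.
have /cvgrPdist_le /(_ (e / 2)) :
    GRing.exp (1 - c * h) n * M @[n --> \oo] --> 0 * M.
  apply: cvgMl; apply: cvg_expr; rewrite ger0_norm; first by case/andP: ch1.
  by case/andP: ch1 => /ltW.
rewrite divr_gt0// => /(_ isT)[n _ /(_ n (leqnn n))]; rewrite /= mul0r sub0r normrN => Mn.
near=> t.
have tn : 0 <= t - n%:R * h.
  by rewrite subr_ge0; near: t; exact: nbhs_pinfty_ge (num_real _).
have := Wn n _ tn; rewrite subrK => Wt.
have /WM/andP[W0 _] : 0 <= t.
  by rewrite -(subrK (n%:R * h) t) addr_ge0// mulr_ge0// ltW.
rewrite sub0r normrN ger0_norm// (le_trans Wt)//.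
by have := ler_norm ((1 - c * h) ^+ n * M); lra.
Unshelve. all: by end_near. Qed.

Lemma cvg_sum_fin (R : realType) (S : finType) (F : set_system R) {FF : Filter F}
    (f : S -> R -> R) (a : S -> R) :
  (forall i, f i x @[x --> F] --> a i) ->
  \sum_i f i x @[x --> F] --> \sum_i a i.
Proof.
by move=> fa; apply: cvg_big => //; exact: add_continuous.
Qed.

(** By Chapman-Kolmogorov the increment over [h] is an average, under the law [p t x], of increments
    started at time 0. As [S] is finite these are controlled simultaneously, and averaging with
    total mass 1 makes the error uniform in [t] and [x]. *)
Lemma forward_equation (R : realType) (S : finType)
    (p : R -> S -> S -> R) (q : S -> S -> R) (f : S -> R) (e : R) :
  transition_function p -> has_rates p q -> 0 < e ->
  \forall h \near 0^'+, forall t x, 0 <= t ->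
    `|\sum_y p (t + h) x y * f y - \sum_y p t x y * f y
      - h * \sum_z p t x z * \sum_y generator q z y * f y| <= e * h.
Proof.
move=> [p0 p1 pI pD] pq e0.
have near_rate z : \forall h \near (0 : R)^'+,
    `|\sum_y generator q z y * f y
      - \sum_y (p h z y - (z == y)%:R) / h * f y| <= e.
  move: {+}e e0; apply/cvgrPdist_le; apply: cvg_sum_fin => y; apply: cvgMl.
  exact: pq.
have := filter_forall _ near_rate => {}near_rate.
near=> h => t x t0.
have h0 : 0 < h by near: h; exact: nbhs_right_gt.
have rate_h z : `|\sum_y p h z y * f y - f z - h * \sum_y generator q z y * f y|
    <= e * h.
  have : `|\sum_y generator q z y * f y
      - \sum_y (p h z y - (z == y)%:R) / h * f y| <= e.
    by move: z; near: h; exact: near_rate.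
  have -> : \sum_y (p h z y - (z == y)%:R) / h * f y =
      (\sum_y p h z y * f y - f z) / h.
    under eq_bigr do rewrite mulrAC mulrBl.
    rewrite -mulr_suml sumrB; congr ((_ - _) / h).
    rewrite (bigD1 z)//= eqxx mul1r big1 ?addr0// => y /negPf.
    by rewrite eq_sym => ->; rewrite mul0r.
  have factor_h (a b : R) : a - h * b = (a / h - b) * h.
    by rewrite mulrBl divfK ?gt_eqF// [h * _]mulrC.
  by rewrite factor_h normrM (gtr0_norm h0) distrC ler_pM2r.
have -> : \sum_y p (t + h) x y * f y = \sum_z p t x z * \sum_y p h z y * f y.
  under eq_bigr => y _ do rewrite pD ?(ltW h0)// mulr_suml.
  rewrite exchange_big/=; apply: eq_bigr => z _; rewrite mulr_sumr.
  by apply: eq_bigr => y _; rewrite mulrA.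
rewrite mulr_sumr -!sumrB (le_trans (ler_norm_sum _ _ _))//.
rewrite -[leRHS]mul1r -(p1 t x t0) mulr_suml; apply: ler_sum => z _.
rewrite mulrCA -!mulrBr normrM ger0_norm ?p0//.
by apply: ler_wpM2l => //; exact: p0.
Unshelve. all: by end_near. Qed.

(** * Lumping of the types into the particle number *)

Lemma generator_sum (R : realType) (S : finType) (q : S -> S -> R) (f : S -> R)
    (x : S) :
  \sum_y generator q x y * f y = \sum_y q x y * (f y - f x).
Proof.
rewrite (bigD1 x)//= [RHS](bigD1 x)//= subrr mulr0 add0r /generator eqxx.
rewrite mulNr mulr_suml -sumrN -big_split/=; apply: eq_bigr => y /negPf yx.
by rewrite eq_sym yx mulrBr addrC.
Qed.

Lemma sum_ord_delta (R : pzRingType) (n k : nat) (c : nat -> R) :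
  \sum_(i < n) (i == k :> nat)%:R * c i = (k < n)%N%:R * c k.
Proof.
case: ltnP => [kn|nk].
  rewrite (bigD1 (Ordinal kn))//= eqxx big1 ?addr0// => i ik.
  rewrite (_ : (_ == k) = false) ?mul0r//.
  by apply: contraNF ik => /eqP ik; apply/eqP/val_inj.
rewrite big1 ?mul0r// => i _.
by rewrite (ltn_eqF (leq_trans (ltn_ord i) nk)) mul0r.
Qed.

(* The value at [k = 0] is not a rate of the chain; it only ever multiplies a
   vanishing difference or a term of known sign. *)
Definition death_rate (R : realType) (N : nat) (mu : R) (k : nat) : R :=
  mu * (N + k)%:R.

Definition birth_rate (R : realType) (N : nat) (lambda : R) (k : nat) : R :=
  lambda * (N - k)%:R.

Section Lumping.
Variables (R : realType) (N d : nat) (lambda mu : R) (C : 'M[R]_d).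
Hypothesis C_stoch : stochastic_matrix C.

Local Notation rate := (ehrenfest_rate lambda mu C).
Local Notation dr := (death_rate N mu).
Local Notation br := (birth_rate N lambda).

(** Lumpability: the total rate does not depend on the type [i]. At [m = 0] this is the row sum of
    [C], and there is no death since [k.+1] is never 0. *)
Lemma sum_ehrenfest_rate (m k : 'I_N.+1) (i : 'I_d) :
  \sum_j rate (m, i) (k, j) =
  (k.+1 == m :> nat)%:R * dr m + (k == m.+1 :> nat)%:R * br m.
Proof.
rewrite /ehrenfest_rate; case: (eqVneq (m : nat) 0%N) => [->|m0].
  rewrite mul0r add0r; case: eqP => _; last by rewrite mul0r big1.
  under eq_bigr do rewrite -mulrA.
  by rewrite -mulr_suml C_stoch.2 /birth_rate subn0.
rewrite (bigD1 i)//= eqxx/= big1 ?addr0 => [|j /negPf]; last first.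
  by rewrite eq_sym => ->.
case: (eqVneq k.+1 (m : nat)) => [<-|_].
  by rewrite (ltn_eqF (leqnSn _)) mul1r mul0r addr0.
by case: eqP; rewrite ?mul1r !mul0r add0r.
Qed.

Lemma generator_lumped (phi : nat -> R) (x : 'I_N.+1 * 'I_d) :
  \sum_y generator rate x y * phi y.1 =
  dr x.1 * (phi x.1.-1 - phi x.1) + br x.1 * (phi x.1.+1 - phi x.1).
Proof.
case: x => m i /=; rewrite generator_sum.
transitivity (\sum_k \sum_j rate (m, i) (k, j) * (phi k - phi m)).
  by rewrite pair_bigA; apply: eq_bigr => -[].
under eq_bigr => k _.
  rewrite -mulr_suml sum_ehrenfest_rate mulrDl -[_ * dr m * _]mulrA.
  rewrite -[_ * br m * _]mulrA.
  over.
rewrite big_split/=.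
have /= -> := sum_ord_delta N.+1 m.+1 (fun k => br m * (phi k - phi m)).
congr (_ + _).
  (* At 0 the convention [0.-1 = 0] makes the death term vanish. *)
  case: (posnP m) => [->|m0].
    by rewrite subrr mulr0 big1// => k _; rewrite mul0r.
  under eq_bigr do rewrite -[in (_ == _)](prednK m0) eqSS.
  have /= -> := sum_ord_delta N.+1 m.-1 (fun k => dr m * (phi k - phi m)).
  by rewrite (leq_ltn_trans (leq_pred _) (ltn_ord m)) mul1r.
(* At [m = N] the target [m.+1] is out of range, which agrees with the birth rate being 0 there. *)
have [|mN] := ltnP m.+1 N.+1; first by rewrite mul1r.
by rewrite mul0r /birth_rate (eqP (mN : (N - m == 0)%N)) mulr0 mul0r.
Qed.

End Lumping.

(** * Law of the particle number and its distribution function *)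

(** The index is a plain [nat], so shifts and partial sums need no bound; the value is 0 beyond
    [N]. *)
Definition count_prob (R : realType) (N d : nat)
    (p : R -> 'I_N.+1 * 'I_d -> 'I_N.+1 * 'I_d -> R) (x0 : 'I_N.+1 * 'I_d)
    (t : R) (k : nat) : R :=
  \sum_(y : 'I_N.+1 * 'I_d | y.1 == k :> nat) p t x0 y.

Lemma count_prob_delta (R : realType) (N d : nat)
    (p : R -> 'I_N.+1 * 'I_d -> 'I_N.+1 * 'I_d -> R) (x0 : 'I_N.+1 * 'I_d)
    (t : R) (k : nat) :
  count_prob p x0 t k = \sum_(y : 'I_N.+1 * 'I_d) p t x0 y * (y.1 == k :> nat)%:R.
Proof.
rewrite /count_prob big_mkcond; apply: eq_bigr => y _.
by case: eqP; rewrite ?mulr1 ?mulr0.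
Qed.

Lemma count_cdf (R : realType) (N d : nat)
    (p : R -> 'I_N.+1 * 'I_d -> 'I_N.+1 * 'I_d -> R) (x0 : 'I_N.+1 * 'I_d)
    (t : R) (k : nat) :
  \sum_(i < k) count_prob p x0 t i = \sum_(y : 'I_N.+1 * 'I_d) p t x0 y * (y.1 < k)%N%:R.
Proof.
under eq_bigr do rewrite count_prob_delta.
rewrite exchange_big; apply: eq_bigr => y _; rewrite -mulr_sumr; congr (_ * _).
rewrite -[RHS]mulr1 -(sum_ord_delta _ _ (fun=> 1)).
by apply: eq_bigr => i _; rewrite mulr1 eq_sym.
Qed.

(** The forward equation is tested against the indicator of [{0, ..., k}]. What remains is the flux
    across the edge between [k] and [k.+1]. *)
Lemma count_cdf_step (R : realType) (N d : nat) (lambda mu : R) (C : 'M[R]_d)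
    (p : R -> 'I_N.+1 * 'I_d -> 'I_N.+1 * 'I_d -> R) (x0 : 'I_N.+1 * 'I_d)
    (k : nat) (e : R) :
  stochastic_matrix C -> transition_function p ->
  has_rates p (ehrenfest_rate lambda mu C) -> 0 < e ->
  \forall h \near 0^'+, forall t, 0 <= t ->
    `|\sum_(i < k.+1) count_prob p x0 (t + h) i
      - \sum_(i < k.+1) count_prob p x0 t i
      - h * (death_rate N mu k.+1 * count_prob p x0 t k.+1
             - birth_rate N lambda k * count_prob p x0 t k)| <= e * h.
Proof.
move=> Cs pt pr e0; pose phi i : R := (i < k.+1)%N%:R.
have := forward_equation (fun y : 'I_N.+1 * 'I_d => phi y.1) pt pr e0.
apply: filterS => h H t t0.
move: (H t x0 t0); rewrite !count_cdf; congr (`|_ - _ * _| <= _).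
under eq_bigr do rewrite generator_lumped//.
rewrite !count_prob_delta !mulr_sumr -sumrB; apply: eq_bigr => -[m j] _ /=.
rewrite [RHS](_ : _ = p t x0 (m, j) * (death_rate N mu k.+1 *
  (m == k.+1 :> nat)%:R - birth_rate N lambda k * (m == k :> nat)%:R)); last by ring.
congr (_ * _); rewrite /phi.
(* Only a death from [k.+1] or a birth from [k] changes the indicator; for any other [m] both
   differences are 0. *)
case: (ltngtP (m : nat) k.+1) => [mk|mk|->]; last first.
- rewrite /= ltnSn (gtn_eqF (ltnSn k)) ltnNge leqnSn/=.
  by rewrite !subr0 !mulr0 addr0 subr0.
- have mk1 : (m.-1 < k.+1)%N = false.
    by apply/negbTE; rewrite -leqNgt -ltnS prednK// (leq_trans _ mk).
  rewrite mk1 (gtn_eqF (ltnW mk)) (ltnNge m.+1).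
  by rewrite (leqW (ltnW mk))/= !subr0 !mulr0 addr0 subr0.
rewrite (leq_ltn_trans (leq_pred _) mk).
move: mk; rewrite ltnS leq_eqVlt => /predU1P[->|mk].
  by rewrite eqxx ltnn/= subrr !mulr0 mulr1 !add0r mulrN1.
by rewrite (ltn_eqF mk) ltnS mk/= !subrr !mulr0 addr0 subr0.
Qed.

(** * Contraction of the distribution functions and convergence to the stationary law *)

(** Summation by parts moves the index shifts from [a] to the rates. As these are affine in [k],
    every [a k.+1] then has coefficient [- (lambda + mu)]. The boundary terms vanish, except [F 0],
    which has the favourable sign and is dropped. *)
Lemma birth_death_contraction (R : realType) (N : nat) (lambda mu : R)
    (a : nat -> R) :
  0 <= mu -> (forall k, 0 <= a k) -> a 0%N = 0 -> a N.+1 = 0 ->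
  \sum_(k < N) (death_rate N mu k.+1 * a k.+2 + birth_rate N lambda k * a k
    - (death_rate N mu k.+1 + birth_rate N lambda k) * a k.+1)
  <= - (lambda + mu) * \sum_(k < N) a k.+1.
Proof.
move=> mu0 a0 a00 aN; pose F k := death_rate N mu k * a k.+1.
pose G k := birth_rate N lambda k * a k.
have F0 : 0 <= F 0%N by rewrite mulr_ge0// mulr_ge0.
have FE : \sum_(k < N) F k.+1 = \sum_(k < N) F k - F 0%N.
  apply/eqP; rewrite eq_sym subr_eq addrC.
  rewrite -(big_ord_recl N (fun k => F k))/= big_ord_recr/=.
  by rewrite /F aN mulr0 addr0.
have GE : \sum_(k < N) G k = \sum_(k < N) G k.+1.
  transitivity (\sum_(k < N.+1) G k).
    by rewrite big_ord_recr/= /G /birth_rate subnn mulr0 mul0r addr0.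
  by rewrite big_ord_recl/= /G a00 mulr0 add0r.
have drift : \sum_(k < N) F k + \sum_(k < N) G k.+1
    - \sum_(k < N) (death_rate N mu k.+1 + birth_rate N lambda k) * a k.+1 =
    - (lambda + mu) * \sum_(k < N) a k.+1.
  rewrite -big_split/= -sumrB mulr_sumr; apply: eq_bigr => k _.
  rewrite /F /G /death_rate /birth_rate (natrD _ N k) (natrD _ N k.+1).
  rewrite (natrB _ (ltnW (ltn_ord k))) (natrB _ (ltn_ord k)) -[k.+1%:R]natr1.
  by ring.
rewrite sumrB big_split/= -[X in X + _ - _]/(\sum_(k < N) F k.+1).
rewrite -[X in _ + X - _]/(\sum_(k < N) G k) FE GE -drift.
by rewrite lerD2r lerD2r lerBlDr lerDl.
Qed.

Section Convergence.
Variables (R : realType) (N d : nat) (lambda mu : R) (C : 'M[R]_d).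
Variables (p : R -> 'I_N.+1 * 'I_d -> 'I_N.+1 * 'I_d -> R).
Variables (x0 : 'I_N.+1 * 'I_d) (pi : nat -> R).
Hypothesis lambda_gt0 : 0 < lambda.
Hypothesis mu_gt0 : 0 < mu.
Hypothesis C_stoch : stochastic_matrix C.
Hypothesis p_trans : transition_function p.
Hypothesis p_rates : has_rates p (ehrenfest_rate lambda mu C).
Hypothesis pi_balance : forall k, (k < N)%N ->
  death_rate N mu k.+1 * pi k.+1 = birth_rate N lambda k * pi k.
Hypothesis pi_sum : \sum_(k < N.+1) pi k = 1.

(** The sum stops before [k], so [V] vanishes at both ends, 0 and [N.+1]; [W] collects the interior
    indices. *)
Let V t k := \sum_(i < k) (count_prob p x0 t i - pi i).
Let W t := \sum_(k < N) `|V t k.+1|.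

Let VS t k : count_prob p x0 t k - pi k = V t k.+1 - V t k.
Proof. by rewrite /V big_ord_recr/= [RHS]addrC addKr. Qed.

Let V0 t : V t 0 = 0. Proof. exact: big_ord0. Qed.

Let VN t : 0 <= t -> V t N.+1 = 0.
Proof.
move=> t0; rewrite /V sumrB pi_sum count_cdf.
under eq_bigr do rewrite ltn_ord mulr1.
by case: p_trans => _ -> // _ _; rewrite subrr.
Qed.

Let W_bounded t :
  0 <= t -> 0 <= W t <= \sum_(k < N) (1 + `|\sum_(i < k.+1) pi i|).
Proof.
move=> t0; apply/andP; split; first exact: sumr_ge0.
apply: ler_sum => k _; rewrite /V sumrB (le_trans (ler_normB _ _))// lerD2r.
case: p_trans => p_ge0 p_sum _ _.
rewrite count_cdf ger0_norm; last first.
  by apply: sumr_ge0 => y _; rewrite mulr_ge0// p_ge0.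
rewrite -[leRHS](p_sum t x0 t0); apply: ler_sum => y _.
by apply: ler_piMr; [exact: p_ge0|by case: ltnP; rewrite ?ler01].
Qed.

(** Up to the error, [V (t + h) k.+1] is a combination of [V t k], [V t k.+1] and [V t k.+2] whose
    coefficients are nonnegative for small [h]. Absolute values therefore pass inside, and the
    contraction applies to [|V|]. *)
Let W_step (e : R) : 0 < e -> \forall h \near 0^'+, forall t, 0 <= t ->
  W (t + h) <= (1 - (lambda + mu) * h) * W t + e * h.
Proof.
move=> e0.
(* The error is shared among the [N] indices; dividing by [N.+1] also covers [N = 0]. *)
have e1 : 0 < e / N.+1%:R by rewrite divr_gt0.
have near_cdf := filter_forall _ (fun k : 'I_N =>
  count_cdf_step x0 k C_stoch p_trans p_rates e1).
(* For [h] below [1 / B], the diagonal coefficient [1 - h (d + b)] is nonnegative for all [k] at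
   once. *)
have [B [B0 rate_le_B]] : exists B : R, 0 < B /\
    forall k : 'I_N, death_rate N mu k.+1 + birth_rate N lambda k <= B.
  have rate_ge0 k : 0 <= death_rate N mu k.+1 + birth_rate N lambda k.
    by rewrite addr_ge0// mulr_ge0// ltW.
  exists (\sum_(k < N) (death_rate N mu k.+1 + birth_rate N lambda k) + 1).
  split=> [|k]; first by rewrite ltr_wpDl// sumr_ge0.
  by rewrite (bigD1 k)//= -addrA lerDl addr_ge0// sumr_ge0.
near=> h.
have cdf_h : forall (k : 'I_N) t, 0 <= t ->
    `|\sum_(i < k.+1) count_prob p x0 (t + h) i
      - \sum_(i < k.+1) count_prob p x0 t i
      - h * (death_rate N mu k.+1 * count_prob p x0 t k.+1
             - birth_rate N lambda k * count_prob p x0 t k)| <= e / N.+1%:R * h.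
  by near: h; exact: near_cdf.
move=> t t0.
have h0 : 0 < h by near: h; exact: nbhs_right_gt.
have hB (k : 'I_N) : h * (death_rate N mu k.+1 + birth_rate N lambda k) <= 1.
  apply: (@le_trans _ _ (h * B)); first by rewrite ler_pM2l.
  rewrite -ler_pdivlMr// mul1r; near: h; apply: nbhs_right_ltW.
  by rewrite invr_gt0.
pose D k := death_rate N mu k.+1 * `|V t k.+2| + birth_rate N lambda k * `|V t k|
    - (death_rate N mu k.+1 + birth_rate N lambda k) * `|V t k.+1|.
have Vh (k : 'I_N) : `|V (t + h) k.+1| <= `|V t k.+1| + h * D k + e / N.+1%:R * h.
  have := cdf_h k t t0.
  rewrite (_ : _ - _ = V (t + h) k.+1 - ((1 - h * (death_rate N mu k.+1
      + birth_rate N lambda k)) * V t k.+1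
      + h * death_rate N mu k.+1 * V t k.+2
      + h * birth_rate N lambda k * V t k)); last first.
    (* Detailed balance cancels the flux of [pi], leaving a linear expression in the differences
       [V]. *)
    have bal : h * (death_rate N mu k.+1 * pi k.+1) = h * (birth_rate N lambda k * pi k).
      by rewrite pi_balance.
    have qS i : count_prob p x0 t i = pi i + (V t i.+1 - V t i).
      by rewrite -VS addrC subrK.
    have cdfE s : \sum_(i < k.+1) count_prob p x0 s i
        = V s k.+1 + \sum_(i < k.+1) pi i.
      by rewrite /V sumrB subrK.
    rewrite !cdfE !qS; move: bal.
    move: (V t k) (V t k.+1) (V t k.+2) (V (t + h) k.+1) (pi k) (pi k.+1).
    move: (death_rate N mu k.+1) (birth_rate N lambda k) (\sum_(i < k.+1) pi i).
    by move=> *; lra.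
  set u := (X in `|_ - X|) => Vu.
  have : `|u| <= `|V t k.+1| + h * D k.
    have dr0 : 0 <= death_rate N mu k.+1 by rewrite mulr_ge0// ltW.
    have br0 : 0 <= birth_rate N lambda k by rewrite mulr_ge0// ltW.
    move: dr0 br0 (hB k); rewrite /u /D.
    move: (death_rate _ _ _) (birth_rate _ _ _) => dr br dr0 br0 hdb.
    rewrite (le_trans (ler_normD _ _))//.
    rewrite (le_trans (lerD (ler_normD _ _) (lexx _)))//.
    rewrite !normrM (gtr0_norm h0) (ger0_norm dr0) (ger0_norm br0).
    rewrite ger0_norm ?subr_ge0//.
    by lra.
  move=> u_le; rewrite -(subrK u (V (t + h) k.+1)) (le_trans (ler_normD _ _))//.
  by rewrite addrC lerD.
rewrite (le_trans (ler_sum _ (fun k _ => Vh k)))// !big_split/=.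
rewrite -mulr_sumr sumr_const card_ord -[_ *+ N]mulr_natr -/(W t).
have := @birth_death_contraction R N lambda mu (fun k => `|V t k|) (ltW mu_gt0)
  (fun k => normr_ge0 _).
rewrite V0 VN// normr0 => /(_ erefl erefl) WD.
have {}WD : h * \sum_(k < N) D k <= h * (- (lambda + mu) * W t).
  by rewrite ler_pM2l.
have eN : e / N.+1%:R * h * N%:R <= e * h.
  rewrite mulrAC ler_wpM2r ?(ltW h0)// -mulrA ler_piMr ?(ltW e0)//.
  by rewrite mulrC ler_pdivrMr// mul1r ler_nat.
move: WD eN; move: (\sum_(k < N) D k) (W t) (_ * _ * N%:R).
by move=> *; lra.
Unshelve. all: by end_near. Qed.

Lemma count_prob_cvg (k : nat) :
  (k <= N)%N -> count_prob p x0 t k @[t --> +oo] --> pi k.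
Proof.
have W_cvg : W t @[t --> +oo] --> 0.
  exact: discrete_gronwall_cvg0 (addr_gt0 lambda_gt0 mu_gt0) W_bounded W_step.
have V_cvg i : (i <= N.+1)%N -> V t i @[t --> +oo] --> 0.
  move=> iN; apply/norm_cvg0P; apply: (@squeeze_cvgr _ _ _ _ (cst 0) W) W_cvg.
    near=> t; rewrite normr_ge0/=.
    have t0 : 0 <= t by near: t; exact: nbhs_pinfty_ge (num_real _).
    (* The end indices are not summands of [W], but [V] is 0 there. *)
    case: i iN => [|i]; first by rewrite V0 normr0 sumr_ge0.
    rewrite leq_eqVlt => /predU1P[->|iN]; first by rewrite VN// normr0 sumr_ge0.
    by rewrite /W (bigD1 (Ordinal (iN : (i < N)%N)))//= lerDl sumr_ge0.
  exact: cvg_cst.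
move=> kN; rewrite -[pi k]add0r -(subr0 0).
rewrite (_ : (fun t => _) = (fun t => V t k.+1 - V t k + pi k)); last first.
  by apply/funext => t; rewrite -VS subrK.
apply: cvgD; last exact: cvg_cst.
by apply: cvgB; apply: V_cvg; rewrite // leqW.
Unshelve. all: by end_near. Qed.

End Convergence.

(** * The normalising constant as a terminating hypergeometric series *)

(* [N%:R - i%:R] is the real difference, so the weight vanishes for [k > N]. *)
Definition stationary_weight (R : realType) (rho : R) (N k : nat) : R :=
  \prod_(i < k) (rho * (N%:R - i%:R) / (N + i.+1)%:R).

(** In the general term [(1)_n] cancels [n!], and the signs of [(-N)_n] and [(-rho)^n] cancel each
    other. The induction compares ratios of consecutive terms. *)
Lemma hyp2F1_stationary_weight (R : realType) (rho : R) (N : nat) :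
  hyp2F1 (- N%:R) 1 (1 + N%:R) (- rho) =
  \sum_(k < N.+1) stationary_weight rho N k.
Proof.
rewrite /hyp2F1; set u := (fun n => _).
have -> : u = stationary_weight rho N.
  apply/funext => n; rewrite /u {u}; elim: n => [|n IHn].
    by rewrite /pochhammer /stationary_weight !big_ord0 fact0 invr1 !mulr1.
  rewrite /stationary_weight big_ord_recr/= -/(stationary_weight rho N n) -IHn.
  rewrite /pochhammer !big_ord_recr/= factS natrM exprS.
  have n1 : (n.+1%:R : R) != 0 by rewrite pnatr_eq0.
  have Nn1 : ((N + n.+1)%:R : R) != 0 by rewrite pnatr_eq0 addnS.
  have fn : (n`!%:R : R) != 0 by rewrite pnatr_eq0 -lt0n fact_gt0.
  have poch : \prod_(i < n) (1 + N%:R + i%:R) != 0 :> R.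
    by apply/prodf_neq0 => i _; rewrite -addrA -natrD nat1r pnatr_eq0.
  have NnE : (N + n.+1)%:R = 1 + N%:R + n%:R :> R.
    by rewrite addnS -nat1r natrD addrA.
  rewrite NnE in Nn1 *; rewrite -nat1r in n1 *.
  by field; rewrite n1 Nn1 fn poch.
(* Every term of index above [N] contains the factor [N - N], so the partial sums are eventually
   constant. *)
apply: lim_near_cst => //; near=> n; rewrite /series/=.
have Nn : (N.+1 <= n)%N by near: n; exact: nbhs_infty_ge.
rewrite (big_cat_nat _ Nn)//= big_mkord [X in _ + X]big_nat_cond [X in _ + X]big1 ?addr0//.
move=> k /[!andbT] /andP[Nk _].
by rewrite /stationary_weight (bigD1 (Ordinal Nk))//= subrr mulr0 !mul0r.
Unshelve. all: by end_near. Qed.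

(** * Mean and variance from detailed balance *)

Section StationaryMoments.
Variables (R : realType) (N : nat) (rho : R) (pi : nat -> R).
Hypothesis rho_gt0 : 0 < rho.
Hypothesis pi_balance : forall k, (k < N)%N ->
  (N%:R + k.+1%:R) * pi k.+1 = rho * (N%:R - k%:R) * pi k.
Hypothesis pi_sum : \sum_(k < N.+1) pi k = 1.

Let M1 := \sum_(k < N.+1) k%:R * pi k.
Let M2 := \sum_(k < N.+1) k%:R ^+ 2 * pi k.

(** Detailed balance is multiplied by [psi k.+1] and summed. The left side misses its term at 0,
    which is added by hand, and the right side gains the term at [N], which is 0. *)
Lemma stationary_identity (psi : nat -> R) :
  \sum_(k < N.+1) psi k * ((N%:R + k%:R) * pi k) =
  psi 0%N * N%:R * pi 0%N
  + rho * \sum_(k < N.+1) psi k.+1 * ((N%:R - k%:R) * pi k).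
Proof.
rewrite big_ord_recl/= addr0 mulrA; congr (_ + _).
rewrite big_ord_recr/= subrr mul0r mulr0 addr0 mulr_sumr.
by apply: eq_bigr => k _; rewrite pi_balance//; ring.
Qed.

(** Taking [psi = 1] gives [N + M1 = N pi 0 + rho (N - M1)]. *)
Lemma stationary_mean :
  M1 = N%:R / (1 + rho) * (rho - 1 + pi 0%N).
Proof.
have rho1 : 1 + rho != 0 by rewrite gt_eqF// addr_gt0.
have := stationary_identity (fun=> 1).
under eq_bigr do rewrite mul1r mulrDl.
under [X in _ = _ + _ * X]eq_bigr do rewrite mul1r mulrBl.
rewrite big_split sumrB/= -!mulr_sumr pi_sum -/M1 => M1E.
apply: (mulIf rho1); rewrite mulrAC divfK//.
by move: M1E; move: M1 => *; lra.
Qed.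

(** Taking [psi k = k] removes the boundary term and gives a linear equation for [M2] in terms of
    [M1]. *)
Lemma stationary_second_moment :
  M2 = (rho * N%:R + M1 * (rho * N%:R - rho - N%:R)) / (1 + rho).
Proof.
have rho1 : 1 + rho != 0 by rewrite gt_eqF// addr_gt0.
have := stationary_identity (fun k => k%:R).
rewrite !mul0r add0r.
under eq_bigr => k _.
  rewrite (_ : _ * _ = N%:R * (k%:R * pi k) + k%:R ^+ 2 * pi k); last by ring.
  over.
under [X in _ = _ * X]eq_bigr => k _.
  rewrite -nat1r (_ : _ * _ = N%:R * pi k + (N%:R - 1) * (k%:R * pi k)
    - k%:R ^+ 2 * pi k); last by ring.
  over.
rewrite sumrB !big_split/= -!mulr_sumr pi_sum -/M1 -/M2 => M2E.
apply: (mulIf rho1); rewrite divfK//.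
by move: M2E; move: M1 M2 => *; lra.
Qed.

Lemma stationary_variance (m := M1) :
  \sum_(k < N.+1) (k%:R - m) ^+ 2 * pi k =
  N%:R / (1 + rho) ^+ 2 *
    (rho * (2 - pi 0%N - pi 0%N * N%:R) + N%:R * (1 - pi 0%N) * pi 0%N).
Proof.
have rho1 : 1 + rho != 0 by rewrite gt_eqF// addr_gt0.
transitivity (M2 - m ^+ 2).
  under eq_bigr => k _.
    rewrite (_ : _ * _ = k%:R ^+ 2 * pi k - (2 * m) * (k%:R * pi k)
      + m ^+ 2 * pi k); last by ring.
    over.
  by rewrite big_split sumrB/= -!mulr_sumr pi_sum -/M1 -/M2 /m; ring.
rewrite stationary_second_moment /m stationary_mean.
by field.
Qed.

End StationaryMoments.

(** * From probability spaces to finite sums *)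

(** Since the masses at [0, ..., n - 1] add up to 1, the union [A] of these atoms has full measure.
    The integral reduces to [A], and [f \o Y] is constant on each atom. *)
Lemma expectation_pmf (R : realType) (disp : measure_display)
    (Omega : measurableType disp) (P : probability Omega R) (Y : {RV P >-> R})
    (n : nat) (f : R -> R) :
  measurable_fun setT f -> \sum_(k < n) pmf Y (k : nat)%:R = 1 ->
  'E_P[f \o Y]%E = (\sum_(k < n) f k%:R * pmf Y k%:R)%:E.
Proof.
move=> mf pmf1; pose F (k : nat) := Y @^-1` [set k%:R].
have mF k : measurable (F k) by exact: measurable_funPTI.
have PF k : P (F k) = (pmf Y k%:R)%:E by rewrite fineK ?fin_num_measure.
have tF (D : set nat) : trivIset D F.
  by move=> i j _ _ [w [Yi Yj]]; apply/eqP; rewrite -(eqr_nat R) -Yi Yj.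
pose A := \big[setU/set0]_(k < n) F k.
have mA : measurable A by exact: bigsetU_measurable.
have PA : P (~` A) = 0%E.
  rewrite probability_setC// /A (@measure_bigsetU _ _ _ P _ mF)//.
  rewrite (eq_bigr _ (fun (k : 'I_n) _ => PF k)).
  by rewrite sumEFin pmf1 subee.
rewrite unlock.
transitivity (\int[P]_(w in A) (f (Y w))%:E)%E.
  rewrite [RHS]integral_mkcond; apply: ae_eq_integral => //.
  - exact/measurable_EFinP/measurableT_comp.
  - apply/(measurable_restrictT _ _).1 => //; apply: measurable_funTS.
    exact/measurable_EFinP/measurableT_comp.
  - exists (~` A); split=> //; first exact: measurableC.
    by move=> w /= /[swap] Aw; apply => _; rewrite patchT ?inE.
rewrite /A -(big_mkord xpredT F) /index_iota subn0.
rewrite integral_bigsetU_EFin ?iota_uniq//; last first.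
  exact/measurable_funTS/measurable_EFinP/measurableT_comp.
rewrite -sumEFin -(big_mkord xpredT (fun k => (f k%:R * pmf Y k%:R)%:E)).
rewrite /index_iota subn0 /=; apply: eq_bigr => k _.
rewrite EFinM -PF -integral_cst//; apply: eq_integral => w.
by rewrite inE /F /= => Yw; congr (f _)%:E.
Qed.

(** The Markov property is used for the two times 0 and [t], with the almost sure initial state as
    the first. *)
Lemma law_at_time (R : realType) (disp : measure_display)
    (Omega : measurableType disp) (P : probability Omega R) (S : finType)
    (x0 : S) (X : R -> Omega -> S) (p : R -> S -> S -> R) (t : R) (x : S) :
  (forall t x, 0 <= t -> measurable (X t @^-1` [set x])) ->
  P (X 0 @^-1` [set x0]) = 1%E ->
  (forall (n : nat) (t : nat -> R) (x : nat -> S),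
    0 <= t 0%N -> (forall i, t i < t i.+1) ->
    P [set w | forall i, (i <= n.+1)%N -> X (t i) w = x i] =
    (P [set w | forall i, (i <= n)%N -> X (t i) w = x i] *
     (p (t n.+1 - t n) (x n) (x n.+1))%:E)%E) ->
  0 < t -> P (X t @^-1` [set x]) = (p t x0 x)%:E.
Proof.
move=> mX X0 markov t0.
have mX0 : measurable (X 0 @^-1` [set x0]) by exact: mX.
have mXt : measurable (X t @^-1` [set x]) by apply: mX; exact: ltW.
(* The whole sequence of times must increase strictly, hence the multiples of [t > 0]; only the
   first two matter. *)
have := markov 0%N (fun i => i%:R * t) (fun i => if i is 0%N then x0 else x).
rewrite mul0r lexx => /(_ isT) /=.
have -> : [set w | forall i, (i <= 1)%N ->
      X (i%:R * t) w = if i is 0%N then x0 else x] = X 0 @^-1` [set x0] `&` X t @^-1` [set x].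
  apply/seteqP; split=> w /= => [Xw|[Xw0 Xwt] [|[|//]]].
  - by split; [have := Xw 0%N isT|have := Xw 1%N isT]; rewrite ?mul0r ?mul1r.
  - by rewrite mul0r.
  - by rewrite mul1r.
have -> : [set w | forall i, (i <= 0)%N ->
      X (i%:R * t) w = if i is 0%N then x0 else x] = X 0 @^-1` [set x0].
  apply/seteqP; split=> w /= => [Xw|Xw0 [|//]]; last by rewrite mul0r.
  by have := Xw 0%N isT; rewrite mul0r.
rewrite X0 mul1e mul1r subr0 => <-; last first.
  by move=> i; rewrite ltr_pM2r// ltr_nat.
(* The part of the event off the initial state lies in a null set. *)
have -> : P (X t @^-1` [set x]) = (P (X t @^-1` [set x] `\` X 0%R @^-1` [set x0])
    + P (X t @^-1` [set x] `&` X 0%R @^-1` [set x0]))%E by exact: measureDI.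
rewrite [X in (X + _)%E](_ : _ = 0%E) ?add0e 1?setIC//.
apply/eqP; rewrite eq_le measure_ge0 andbT.
have <- : P (~` (X 0%R @^-1` [set x0])) = 0%E.
  by rewrite probability_setC// X0 subee.
by apply: le_measure; rewrite ?inE; [exact: measurableD|exact: measurableC|move=> w []].
Qed.

Lemma number_law_count (R : realType) (disp : measure_display)
    (Omega : measurableType disp) (P : probability Omega R) (N d : nat)
    (X : R -> Omega -> 'I_N.+1 * 'I_d)
    (p : R -> 'I_N.+1 * 'I_d -> 'I_N.+1 * 'I_d -> R) (x0 : 'I_N.+1 * 'I_d)
    (t : R) (k : 'I_N.+1) :
  (forall x, measurable (X t @^-1` [set x])) ->
  (forall x, P (X t @^-1` [set x]) = (p t x0 x)%:E) ->
  number_law P X k t = count_prob p x0 t k.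
Proof.
move=> mX PX; rewrite /number_law /count_prob.
pose s := enum [pred y : 'I_N.+1 * 'I_d | y.1 == k :> nat].
have -> : [set w | (X t w).1 = k] = \bigcup_(y in [set` s]) (X t @^-1` [set y]).
  apply/seteqP; split=> [w /= Xw|w [y ys Xw]]; last first.
    by move: ys; rewrite -Xw /= mem_enum => /eqP/val_inj.
  by exists (X t w) => //=; rewrite mem_enum inE Xw.
rewrite measure_fin_bigcup//; last by move=> i j _ _ [w [/= <- <-]].
rewrite -fsbig_seq ?enum_uniq// big_enum.
by rewrite (eq_bigr _ (fun y _ => PX y)) sumEFin.
Qed.

Theorem proposition4p3 (R : realType) (N d : nat) (lambda mu : R)
    (C : 'M[R]_d) (l0 : 'I_d)
    (disp : measure_display) (Omega : measurableType disp)
    (P : probability Omega R) (X : R -> Omega -> 'I_N.+1 * 'I_d) :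
  (0 < N)%N -> 0 < lambda -> 0 < mu -> stochastic_matrix C ->
  markov_chain P (ehrenfest_rate lambda mu C) (ord0, l0) X ->
  let rho := lambda / mu in
  let g := 1 / hyp2F1 (- N%:R) 1 (1 + N%:R) (- rho) in
  (forall k : 'I_N.+1, cvg (number_law P X k t @[t --> +oo])) /\
  forall (disp' : measure_display) (Omega' : measurableType disp')
    (P' : probability Omega' R) (Y : {RV P' >-> R}),
    (forall k : 'I_N.+1,
       pmf Y (k : nat)%:R = lim (number_law P X k t @[t --> +oo])) ->
    [/\ ('E_P'[Y])%E = (N%:R / (1 + rho) * (rho - 1 + g))%:E,
        ('V_P'[Y])%E = (N%:R / (1 + rho) ^+ 2 *
                    (rho * (2 - g - g * N%:R) + N%:R * (1 - g) * g))%:E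
      & coefficient_of_variation P' Y =
        Num.sqrt (rho * (2 - g) / (N%:R * (rho - 1 + g) ^+ 2)
                  - g / (rho - 1 + g))].
Proof.
move=> N0 lambda0 mu0 C_stoch [mX X0 [p [p_trans p_rates markov]]] rho.
rewrite hyp2F1_stationary_weight => g.
have rho0 : 0 < rho by rewrite divr_gt0.
pose w := stationary_weight rho N.
have w_step k : w k.+1 = w k * (rho * (N%:R - k%:R) / (N + k.+1)%:R).
  exact: big_ord_recr.
have w0 : w 0%N = 1 by exact: big_ord0.
have w_ge0 (k : 'I_N.+1) : 0 <= w k.
  apply: prodr_ge0 => i _; rewrite divr_ge0// mulr_ge0 ?(ltW rho0)// subr_ge0.
  by rewrite ler_nat ltnW// (leq_trans (ltn_ord i))// -ltnS.
have S0 : 0 < \sum_(k < N.+1) w k.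
  by rewrite big_ord_recl w0 ltr_pwDl// sumr_ge0// => k _; exact: w_ge0 (lift _ k).
have g0 : 0 < g by rewrite divr_gt0.
(* The normalised weights form the detailed-balance law; as [w 0 = 1], the quantity [g] is its mass
   at 0. *)
pose pi k := g * w k.
have pi0 : pi 0%N = g by rewrite /pi w0 mulr1.
have pi_sum : \sum_(k < N.+1) pi k = 1.
  by rewrite -mulr_sumr /g div1r mulVf ?gt_eqF.
have balance k : (N%:R + k.+1%:R) * pi k.+1 = rho * (N%:R - k%:R) * pi k.
  have Nk : N%:R + k.+1%:R != 0 :> R by rewrite -natrD addnS pnatr_eq0.
  by rewrite /pi w_step natrD; field.
have law_cvg (k : 'I_N.+1) : number_law P X k t @[t --> +oo] --> pi k.
  have kN : (k <= N)%N by rewrite -ltnS.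
  have cvg_pi : count_prob p (ord0, l0) t k @[t --> +oo] --> pi k.
    apply: (count_prob_cvg _ lambda0 mu0 C_stoch p_trans p_rates _ pi_sum kN).
    move=> j jN; rewrite /death_rate /birth_rate natrD (natrB _ (ltnW jN)).
    rewrite -!mulrA balance /rho; field.
    by rewrite gt_eqF.
  apply: cvg_trans cvg_pi; apply: near_eq_cvg; near=> t.
  have t0 : 0 < t by near: t; exact: nbhs_pinfty_gt (num_real _).
  rewrite (@number_law_count _ _ _ _ _ _ _ p (ord0, l0))// => x.
    by apply: mX; exact: ltW.
  exact: law_at_time.
split=> [k|disp' Omega' P' Y Ylaw]; first exact: cvgP (law_cvg k).
have pmfY (k : 'I_N.+1) : pmf Y (k : nat)%:R = pi k.
  by rewrite Ylaw; exact: cvg_lim.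
have pmf_sum : \sum_(k < N.+1) pmf Y (k : nat)%:R = 1.
  by rewrite (eq_bigr _ (fun k _ => pmfY k)).
have EY : 'E_P'[Y]%E = (N%:R / (1 + rho) * (rho - 1 + g))%:E.
  rewrite (@expectation_pmf _ _ _ _ Y _ id _ pmf_sum)// -pi0.
  rewrite -(stationary_mean rho0 (fun k _ => balance k) pi_sum).
  by congr (_%:E); apply: eq_bigr => k _; rewrite pmfY.
have VY : 'V_P'[Y]%E = (N%:R / (1 + rho) ^+ 2 *
    (rho * (2 - g - g * N%:R) + N%:R * (1 - g) * g))%:E.
  rewrite /variance covariance.unlock EY /=.
  set m := _ / _ * _.
  have mE : \sum_(k < N.+1) k%:R * pi k = m.
    by rewrite /m -pi0; exact: stationary_mean (fun k _ => balance k) pi_sum.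
  have mf : measurable_fun setT (fun y : R => (y - m) ^+ 2).
    by apply: measurable_funX; exact: measurable_funB.
  have -> : (Y \- cst m) * (Y \- cst m) = (fun y => (y - m) ^+ 2) \o Y.
    by apply/funext => z; rewrite /= expr2.
  rewrite (expectation_pmf mf pmf_sum).
  rewrite -pi0 -(stationary_variance rho0 (fun k _ => balance k) pi_sum) mE.
  by congr (_%:E); apply: eq_bigr => k _; rewrite pmfY.
split=> //.
rewrite /coefficient_of_variation EY VY /=.
(* The mean is positive because [N > 0] puts mass on [k = 1]. This gives [rho - 1 + g != 0] and lets
   the mean leave the square root without an absolute value. *)
have m0 : 0 < N%:R / (1 + rho) * (rho - 1 + g).
  rewrite -pi0 -(stationary_mean rho0 (fun k _ => balance k) pi_sum).
  rewrite (bigD1 (Ordinal (N0 : (1 < N.+1)%N)))//= mul1r ltr_pwDl//.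
    apply: mulr_gt0 => //.
    by rewrite w_step w0 mul1r subr0 divr_gt0 ?mulr_gt0 ?invr_gt0 ?ltr0n ?addn1.
  by apply: sumr_ge0 => k _; rewrite mulr_ge0// mulr_ge0// ltW.
have N0' : 0 < N%:R :> R by rewrite ltr0n.
have rho1 : 0 < 1 + rho by rewrite addr_gt0.
have q0 : rho - 1 + g != 0.
  by move: m0; rewrite pmulr_rgt0 ?divr_gt0// => /gt_eqF ->.
set m := _ / _ * _ in m0 *; set v := _ / _ * _.
have -> : rho * (2 - g) / (N%:R * (rho - 1 + g) ^+ 2) - g / (rho - 1 + g) =
    m^-1 ^+ 2 * v.
  by rewrite /m /v; field; rewrite q0 !gt_eqF.
by rewrite [RHS]sqrtrM ?sqr_ge0// sqrtr_sqr gtr0_norm ?invr_gt0// mulrC.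
Unshelve. all: by end_near. Qed.
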